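(* Let $(A,B,C)$ be a minimal system with $A\in\mathbb{R}^{n\times n}$, $B\in\mathbb{R}^{n\times m}$, $C\in\mathbb{R}^{m\times n}$. Consider the following conditions on invertible matrices $\Omega,G,R\in\mathbb{R}^{n\times n}$: (H) $A^\top\Omega+\Omega A=0$, $B^\top\Omega=C$, $\Omega=-\Omega^\top$; (S) $A^\top G=GA$, $B^\top G=C$, $G=G^\top$; (T) $RA=-AR$, $RB=-B$, $C=CR$, $R=R^{-1}$. Then: 1. If invertible $\Omega$ and $G$ satisfy (H) and (S), then $G\Omega^{-1}G=\Omega$, and $R:=\Omega^{-1}G$ satisfies (T). 2. If invertible $G$ and $R$ satisfy (S) and (T), then $R^\top GR=-G$, and $\Omega:=GR$ satisfies (H). 3. If invertible $R$ and $\Omega$ satisfy (T) and (H), then $R^\top\Omega R=-\Omega$, and $G:=\Omega R$ satisfies (S). Hence if the system satisfies two out of the three conditions (existence of invertible $\Omega$ with (H), of invertible $G$ with (S), of invertible $R$ with (T)), then it also satisfies the third.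
   Context: The system $(A,B,C)$ is $\dot x=Ax+Bu$, $y=Cx$; minimal means that $(A,B)$ is controllable and $(C,A)$ is observable. The three conditions (H), (S), (T) express, respectively, that the system is input-output Hamiltonian, reciprocal, and time-reversible. *)

(* Defs.v *)
From mathcomp Require Import all_boot all_order all_algebra.
From mathcomp Require Import all_classical all_reals all_analysis.

Set Implicit Arguments.
Unset Strict Implicit.
Unset Printing Implicit Defensive.

Import Order.TTheory GRing.Theory Num.Theory.
Import numFieldNormedType.Exports.
Local Open Scope classical_set_scope.
Local Open Scope ring_scope.

(* x' = A x + B u on the whole time axis, with a continuous input u. *)
Definition trajectory (K : realType) (n m : nat) (A : 'M[K]_n)
    (B : 'M[K]_(n, m)) (u : K -> 'cV[K]_m) (x : K -> 'cV[K]_n) : Prop :=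
  continuous u /\ forall t : K, is_derive t 1 x (A *m x t + B *m u t).

Definition controllable (K : realType) (n m : nat) (A : 'M[K]_n)
    (B : 'M[K]_(n, m)) : Prop :=
  forall x0 x1 : 'cV[K]_n, exists T : K, exists u : K -> 'cV[K]_m,
  exists x : K -> 'cV[K]_n,
    [/\ 0 < T, trajectory A B u x, x 0 = x0 & x T = x1].

(* By linearity the input plays no role, so only x' = A x is considered. *)
Definition observable (K : realType) (n p : nat) (C : 'M[K]_(p, n))
    (A : 'M[K]_n) : Prop :=
  forall x z : K -> 'cV[K]_n,
    (forall t : K, is_derive t 1 x (A *m x t)) ->
    (forall t : K, is_derive t 1 z (A *m z t)) ->
    (forall t : K, 0 <= t -> C *m x t = C *m z t) ->
    x 0 = z 0.

Definition minimal_system (K : realType) (n m p : nat) (A : 'M[K]_n)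
    (B : 'M[K]_(n, m)) (C : 'M[K]_(p, n)) : Prop :=
  controllable A B /\ observable C A.

Definition io_hamiltonian (K : realType) (n m : nat) (A : 'M[K]_n)
    (B : 'M[K]_(n, m)) (C : 'M[K]_(m, n)) (Omega : 'M[K]_n) : Prop :=
  [/\ Omega \in unitmx, A^T *m Omega + Omega *m A = 0, B^T *m Omega = C
    & Omega = - Omega^T].

Definition reciprocal (K : realType) (n m : nat) (A : 'M[K]_n)
    (B : 'M[K]_(n, m)) (C : 'M[K]_(m, n)) (G : 'M[K]_n) : Prop :=
  [/\ G \in unitmx, A^T *m G = G *m A, B^T *m G = C & G = G^T].

(* [invmx] is the identity on singular matrices, so the last equation is
   meaningful only together with the first one. *)
Definition time_reversible (K : realType) (n m : nat) (A : 'M[K]_n)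
    (B : 'M[K]_(n, m)) (C : 'M[K]_(m, n)) (R : 'M[K]_n) : Prop :=
  [/\ R \in unitmx, R *m A = - (A *m R), R *m B = - B, C = C *m R
    & R = invmx R].

(* Main.v *)
(* Minimality enters only through the fact that a state transformation S that
   commutes with A and fixes B and C is the identity.  For M = S - 1 and a
   trajectory x steering 0 to x1, the function M x solves the autonomous
   equation y' = A y and is unobservable, so observability forces it to vanish
   at every time: M x1 = 0.  The theorem then compares two matrices that both
   intertwine the system with its dual: G Omega^-1 G with Omega, R^T G R with
   - G, and R^T Omega R with - Omega. *)

Require Import Defs.
From mathcomp Require Import all_boot all_order all_algebra.
From mathcomp Require Import all_classical all_reals all_analysis.
Import Order.TTheory GRing.Theory Num.Theory.
Import numFieldNormedType.Exports.
Local Open Scope ring_scope.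

Set Implicit Arguments.
Unset Strict Implicit.
Unset Printing Implicit Defensive.

(** Differentiation is entrywise, and each entry of the product is a finite linear combination of
    entries of [x] with constant coefficients. *)
Lemma is_derive_mulmx (R : realType) (V : normedModType R) (p q r : nat)
    (M : 'M[R]_(p, q)) (x : V -> 'M[R]_(q, r)) (dx : 'M[R]_(q, r)) (t v : V) :
  is_derive t v x dx -> is_derive t v (fun s => M *m x s) (M *m dx).
Proof.
move=> [xd xE].
have coord k j : is_derive t v (fun s => x s k j) (dx k j).
  apply: DeriveDef; first exact: (derivable_mxP x t v).1.
  by rewrite -xE derive_mx// mxE.
have mcoord i j : is_derive t v (fun s => (M *m x s) i j) ((M *m dx) i j).
  rewrite mxE [X in is_derive _ _ X _](_ : _ =
    \sum_(k < q) (M i k \*: (fun s => x s k j))).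
    by apply: is_derive_sum => k; apply: is_deriveZ.
  by apply/funext => s; rewrite mxE fct_sumE.
have d : derivable (fun s => M *m x s) t v.
  by apply/derivable_mxP => i j; case: (mcoord i j).
apply: DeriveDef => //; apply/matrixP => i j.
by rewrite derive_mx// mxE; case: (mcoord i j).
Qed.

Lemma is_derive_translate (R : realType) (W : normedModType R) (f : R -> W)
    (df : W) (s t v : R) :
  is_derive (t + s) v f df -> is_derive t v (fun h => f (h + s)) df.
Proof.
(* The two difference quotients differ only in the bracketing of the sum inside [f]. *)
have E : (fun h => h^-1 *: (f (h *: v + t + s) - f (t + s))) =
         (fun h => h^-1 *: (f (h *: v + (t + s)) - f (t + s))).
  by apply/funext => h; rewrite addrA.
by move=> [fd fE]; apply: DeriveDef; [move: fd | move: fE];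
   rewrite /derivable /derive /= E.
Qed.

Lemma minimal_annihilator (K : realType) (n m p : nat) (A : 'M[K]_n)
    (B : 'M[K]_(n, m)) (C : 'M[K]_(p, n)) (M : 'M[K]_n) :
  minimal_system A B C -> M *m A = A *m M -> M *m B = 0 -> C *m M = 0 ->
  M = 0.
Proof.
move=> [ctrl obs] MA MB CM.
suff M0 (x1 : 'cV[K]_n) : M *m x1 = 0.
  apply/matrixP => i j.
  by have /colP/(_ i) := M0 (delta_mx j 0); rewrite -colE !mxE.
have [T [u [x [_ [_ xt] _ xT]]]] := ctrl 0 x1.
(* Observability compares states at time 0, so time is shifted by [T] to bring [x1] there; the rival
   solution is the zero one. *)
have := obs (fun t => M *m x (t + T)) (fun=> 0).
rewrite add0r xT; apply.
- move=> t; apply: (@is_derive_translate _ _ (fun s => M *m x s)).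
  (* The added zero is [M *m B *m u (t + T)], which completes [M *m A *m x] to [M] times the
     controlled vector field. *)
  rewrite mulmxA -MA -mulmxA -[M *m (A *m _)]addr0 -(mul0mx _ (u (t + T))).
  by rewrite -MB -mulmxA -mulmxDr; exact: is_derive_mulmx.
- by move=> t; rewrite mulmx0; exact: is_derive_cst.
- by move=> t _; rewrite mulmxA CM mul0mx mulmx0.
Qed.

Lemma minimal_state_rigid (K : realType) (n m p : nat) (A : 'M[K]_n)
    (B : 'M[K]_(n, m)) (C : 'M[K]_(p, n)) (S : 'M[K]_n) :
  minimal_system A B C -> S *m A = A *m S -> S *m B = B -> C *m S = C ->
  S = 1%:M.
Proof.
move=> hmin SA SB CS; apply/eqP; rewrite -subr_eq0; apply/eqP.
apply: (minimal_annihilator hmin).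
- by rewrite mulmxBl mulmxBr SA mul1mx mulmx1.
- by rewrite mulmxBl SB mul1mx subrr.
- by rewrite mulmxBr CS mulmx1 subrr.
Qed.

(** Both [N] and [P] carry the system to one and the same system with state matrix [A'] and output
    matrix [C'], so [invmx P *m N] is a symmetry of the original and rigidity applies. Below, [A']
    and [C'] are [A^T] and [B^T] up to sign, as in the dual system. *)
Lemma minimal_intertwiner_unique (K : realType) (n m : nat) (A A' : 'M[K]_n)
    (B : 'M[K]_(n, m)) (C C' : 'M[K]_(m, n)) (N P : 'M[K]_n) :
  minimal_system A B C -> P \in unitmx ->
  A' *m P = P *m A -> A' *m N = N *m A -> N *m B = P *m B ->
  C' *m P = C -> C' *m N = C -> N = P.
Proof.
move=> hmin Pu AP AN NB CP CN.
suff S1 : invmx P *m N = 1%:M by rewrite -[N](mulKVmx Pu) S1 mulmx1.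
apply: (minimal_state_rigid hmin).
- have PA' : invmx P *m A' = A *m invmx P.
    by apply: (can_inj (mulmxK Pu)); rewrite mulmxKV// -mulmxA AP mulKmx.
  by rewrite -mulmxA -AN mulmxA PA' mulmxA.
- by rewrite -mulmxA NB mulKmx.
- by rewrite -{1}CP mulmxA mulmxK.
Qed.

Lemma hamiltonian_reciprocal (K : realType) (n m : nat) (A : 'M[K]_n)
    (B : 'M[K]_(n, m)) (C : 'M[K]_(m, n)) (Omega G : 'M[K]_n) :
  minimal_system A B C -> io_hamiltonian A B C Omega -> reciprocal A B C G ->
  G *m invmx Omega *m G = Omega /\ time_reversible A B C (invmx Omega *m G).
Proof.
move=> hmin [Wu AW0 BW WT] [Gu AG BG GT].
have AW : A^T *m Omega = - (Omega *m A) by apply/eqP; rewrite -addr_eq0 AW0.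
have WB : Omega *m B = - C^T by rewrite {1}WT mulNmx -BW trmx_mul trmxK.
have GB : G *m B = C^T by rewrite -BG trmx_mul trmxK -GT.
have WA : invmx Omega *m A^T = - (A *m invmx Omega).
  apply: (can_inj (mulmxK Wu)).
  by rewrite mulNmx mulmxKV// -mulmxA AW mulmxN mulKmx.
have RA : invmx Omega *m G *m A = - (A *m (invmx Omega *m G)).
  by rewrite -mulmxA -AG mulmxA WA mulNmx mulmxA.
have RB : invmx Omega *m G *m B = - B.
  by rewrite -mulmxA GB -[C^T]opprK -WB mulmxN mulKmx.
have CR : C *m (invmx Omega *m G) = C by rewrite -{1}BW mulmxA mulmxK.
have GWG : G *m invmx Omega *m G = Omega.
  (* Both matrices intertwine [A] with [- A^T] and send [B] to [- C^T]. *)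
  apply: (minimal_intertwiner_unique (A' := - A^T) (C' := B^T) hmin Wu) => //.
  - by rewrite mulNmx AW opprK.
  - by rewrite -!mulmxA (mulmxA _ G A) RA mulNmx mulmxN (mulmxA A^T) AG
      -!mulmxA.
  - by rewrite -!mulmxA (mulmxA _ G B) RB mulmxN GB WB.
  - by rewrite -mulmxA mulmxA BG.
have Ru : invmx Omega *m G \in unitmx by rewrite unitmx_mul unitmx_inv Wu.
split=> //; split=> //.
(* After multiplication by [R] on the right the claim is that [R] squares to the identity, and
   [R *m R] is [invmx Omega] times the matrix in [GWG]. *)
apply: (can_inj (mulmxK Ru)).
by rewrite mulVmx// -mulmxA (mulmxA G) GWG mulVmx.
Qed.

Lemma reciprocal_reversible (K : realType) (n m : nat) (A : 'M[K]_n)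
    (B : 'M[K]_(n, m)) (C : 'M[K]_(m, n)) (G R : 'M[K]_n) :
  minimal_system A B C -> reciprocal A B C G -> time_reversible A B C R ->
  R^T *m G *m R = - G /\ io_hamiltonian A B C (G *m R).
Proof.
move=> hmin [Gu AG BG GT] [Ru RA RB CR RV].
have GB : G *m B = C^T by rewrite -BG trmx_mul trmxK -GT.
have RR : R *m R = 1%:M by rewrite {1}RV mulVmx.
have AR : A^T *m R^T = - (R^T *m A^T).
  by rewrite -!trmx_mul RA linearN.
have RTB : B^T *m R^T = - B^T by rewrite -trmx_mul RB linearN.
have RGR : R^T *m G *m R = - G.
  (* Conjugation by [R] changes the sign of [A] twice, so the target keeps [A^T]; the sign of [B]
     changes once, whence [- B^T]. *)
  apply: (minimal_intertwiner_unique (A' := A^T) (C' := - B^T) hmin).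
  - by rewrite -scaleN1r unitmxZ// unitrN1.
  - by rewrite mulmxN AG mulNmx.
  - by rewrite !mulmxA AR !mulNmx -(mulmxA _ _ G) AG -!mulmxA RA !mulmxN.
  - by rewrite -!mulmxA RB !mulmxN mulNmx GB -trmx_mul -CR.
  - by rewrite mulNmx mulmxN opprK.
  - by rewrite !mulmxA mulNmx RTB opprK BG -CR.
split=> //; split.
- by rewrite unitmx_mul Gu.
- by rewrite mulmxA AG -!mulmxA -mulmxDr RA subrr mulmx0.
- by rewrite mulmxA BG -CR.
(* Inserting [R *m R] after [R^T *m G] exposes [R^T *m G *m R], whose value [- G] gives the
   skew-symmetry. *)
- by rewrite trmx_mul -GT -[R^T *m G]mulmx1 -RR mulmxA RGR mulNmx opprK.
Qed.

Lemma reversible_hamiltonian (K : realType) (n m : nat) (A : 'M[K]_n)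
    (B : 'M[K]_(n, m)) (C : 'M[K]_(m, n)) (R Omega : 'M[K]_n) :
  minimal_system A B C -> time_reversible A B C R ->
  io_hamiltonian A B C Omega ->
  R^T *m Omega *m R = - Omega /\ reciprocal A B C (Omega *m R).
Proof.
move=> hmin [Ru RA RB CR RV] [Wu AW0 BW WT].
have AW : A^T *m Omega = - (Omega *m A) by apply/eqP; rewrite -addr_eq0 AW0.
have WB : Omega *m B = - C^T by rewrite {1}WT mulNmx -BW trmx_mul trmxK.
have RR : R *m R = 1%:M by rewrite {1}RV mulVmx.
have AR : A^T *m R^T = - (R^T *m A^T).
  by rewrite -!trmx_mul RA linearN.
have RTB : B^T *m R^T = - B^T by rewrite -trmx_mul RB linearN.
have RWR : R^T *m Omega *m R = - Omega.
  apply: (minimal_intertwiner_unique (A' := - A^T) (C' := - B^T) hmin).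
  - by rewrite -scaleN1r unitmxZ// unitrN1.
  - by rewrite mulmxN !mulNmx AW opprK.
  - by rewrite !mulNmx !mulmxA AR !mulNmx opprK -(mulmxA _ _ Omega) AW
      mulmxN mulNmx -!mulmxA RA !mulmxN.
  - by rewrite -!mulmxA RB !mulmxN mulNmx WB mulmxN !opprK -trmx_mul -CR.
  - by rewrite mulNmx mulmxN opprK.
  - by rewrite !mulmxA mulNmx RTB opprK BW -CR.
split=> //; split.
- by rewrite unitmx_mul Wu.
- by rewrite mulmxA AW mulNmx -!mulmxA RA mulmxN.
- by rewrite mulmxA BW -CR.
(* The sign from the skew-symmetry of [Omega] cancels the one in [RWR], so the product is
   symmetric. *)
- have -> : (Omega *m R)^T = - (R^T *m Omega).
    by rewrite trmx_mul {2}WT mulmxN opprK.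
  by rewrite -[R^T *m Omega]mulmx1 -RR mulmxA RWR mulNmx opprK.
Qed.

Theorem proposition7 (K : realType) (n m : nat) (A : 'M[K]_n)
    (B : 'M[K]_(n, m)) (C : 'M[K]_(m, n)) (hmin : minimal_system A B C) :
  (forall Omega G : 'M[K]_n,
      io_hamiltonian A B C Omega -> reciprocal A B C G ->
      G *m invmx Omega *m G = Omega /\
      time_reversible A B C (invmx Omega *m G)) /\
  (forall G R : 'M[K]_n,
      reciprocal A B C G -> time_reversible A B C R ->
      R^T *m G *m R = - G /\ io_hamiltonian A B C (G *m R)) /\
  (forall R Omega : 'M[K]_n,
      time_reversible A B C R -> io_hamiltonian A B C Omega ->
      R^T *m Omega *m R = - Omega /\ reciprocal A B C (Omega *m R)) /\
  ((exists Omega : 'M[K]_n, io_hamiltonian A B C Omega) ->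
   (exists G : 'M[K]_n, reciprocal A B C G) ->
   exists R : 'M[K]_n, time_reversible A B C R) /\
  ((exists G : 'M[K]_n, reciprocal A B C G) ->
   (exists R : 'M[K]_n, time_reversible A B C R) ->
   exists Omega : 'M[K]_n, io_hamiltonian A B C Omega) /\
  ((exists R : 'M[K]_n, time_reversible A B C R) ->
   (exists Omega : 'M[K]_n, io_hamiltonian A B C Omega) ->
   exists G : 'M[K]_n, reciprocal A B C G).
Proof.
split=> [W G|]; first exact: hamiltonian_reciprocal.
split=> [G R|]; first exact: reciprocal_reversible.
split=> [R W|]; first exact: reversible_hamiltonian.
split=> [[W HW] [G HG]|].
  by exists (invmx W *m G); case: (hamiltonian_reciprocal hmin HW HG).
split=> [[G HG] [R HR]|[R HR] [W HW]].
  by exists (G *m R); case: (reciprocal_reversible hmin HG HR).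
by exists (W *m R); case: (reversible_hamiltonian hmin HR HW).
Qed.
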